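(* Let $B$ be a skew-symmetric $n\times n$ integer matrix and let $\widetilde B$ be an $(n+r)\times n$ integer matrix whose top $n\times n$ submatrix is $B$. If $\mathcal A(\widetilde B)$ has the proper Laurent monomial property, then any positive element of $\mathcal A(\widetilde B)$ that belongs to the $\mathbb Z\mathbb P$-submodule of $\mathcal A(\widetilde B)$ spanned by all cluster monomials is a $\mathbb Z_{\geq 0}\mathbb P$-linear combination of cluster monomials. Furthermore, cluster monomials are linearly independent over $\mathbb Z\mathbb P$.
   Context: **Cluster algebras of geometric type.** Let $n\geq1$, $r\ge0$, and let $\mathbb P$ be the free abelian group (written multiplicatively) on symbols $x_{n+1},\ldots,x_{n+r}$ (the underlying group of the tropical semifield); $\mathbb Z\mathbb P$ is its group ring, i.e. the ring of Laurent polynomials in $x_{n+1},\ldots,x_{n+r}$ with integer coefficients, and $\mathbb Z_{\ge0}\mathbb P\subset\mathbb Z\mathbb P$ is the subset of elements with non-negative integer coefficients. Let $\mathcal F$ be a field isomorphic to the field of rational functions in $n$ variables over the fraction field $\mathbb{Q}\mathbb{P}$ of $\mathbb Z\mathbb P$. A (labeled) seed is a pair $(\widetilde B,\mathbf x)$ where $\mathbf x=(x_1,\ldots,x_n)$ is an $n$-tuple of algebraically independent elements of $\mathcal F$ generating $\mathcal F$ over $\mathbb{Q}\mathbb{P}$ (the cluster), and $\widetilde B=(b_{kj})$ is an $(n+r)\times n$ integer matrix whose top $n\times n$ submatrix is skew-symmetric. For $i\in\{1,\ldots,n\}$ the mutation $\mu_i(\widetilde B,\mathbf x)=(\widetilde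 B',\mathbf x')$ is given by $b'_{kj}=-b_{kj}$ if $k=i$ or $j=i$, $b'_{kj}=b_{kj}+\frac{b_{ki}|b_{ij}|+|b_{ki}|b_{ij}}2$ otherwise; $x'_k=x_k$ for $k\ne i$ and $x'_i=x_i^{-1}\left(\prod_{j=1}^{n+r}x_j^{[b_{ji}]_+}+\prod_{j=1}^{n+r}x_j^{[-b_{ji}]_+}\right)$, where $[b]_+=\max(0,b)$. The cluster algebra $\mathcal A(\widetilde B)$ is the $\mathbb Z\mathbb P$-subalgebra of $\mathcal F$ generated by all elements of all clusters of seeds obtained from an initial seed $(\widetilde B,\mathbf x)$ by finite sequences of mutations; these are the clusters of $\mathcal A(\widetilde B)$. By the Laurent phenomenon, every element of $\mathcal A(\widetilde B)$ is, for each cluster $\mathbf x$, a Laurent polynomial in $\mathbf x$ with coefficients in $\mathbb Z\mathbb P$. **Definitions.** A cluster monomial is a product $x_1^{a_1}\cdots x_n^{a_n}$ with $a_k\in\mathbb Z_{\geq 0}$ and $(x_1,\ldots,x_n)$ a cluster of $\mathcal A(\widetilde B)$. An element of $\mathcal A(\widetilde B)$ is positive if its Laurent expansion with respect to each cluster has coefficients in $\mathbb Z_{\ge0}\mathbb P$. A proper Laurent monomial in a cluster $\mathbf x=(x_1,\ldots,x_n)$ is a product $x_1^{c_1}\cdots x_n^{c_n}$ with $c_l\in\mathbb Z$ and at least one $c_l<0$. $\mathcal A(\widetilde B)$ has the proper Laurent monomial property if for any two different clusters $\mathbf x$ and $\mathbf x'$ of $\mathcal A(\widetilde B)$, every monomial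 in $\mathbf x'$ in which at least one element of $\mathbf x'\setminus\mathbf x$ appears with positive exponent is a $\mathbb Z\mathbb P$-linear combination of proper Laurent monomials in $\mathbf x$ (clusters being regarded as unordered sets here). *)

(* Defs.v *)
From HB Require Import structures.
From mathcomp Require Import all_boot all_order all_algebra.
From mathcomp Require Import finmap.
From mathcomp Require Import mpoly.

Set Implicit Arguments.
Unset Strict Implicit.
Unset Printing Implicit Defensive.

Import Order.TTheory GRing.Theory Num.Theory.

Local Open Scope ring_scope.
Local Notation tofrac := (@FracField.tofrac _).

(* [laurent R m] is the type of Laurent polynomials in m variables over R,      *)
(* given by their finitely supported coefficient function on Z^m.              *)
Definition laurent (R : nmodType) (m : nat) : Type :=
  {fsfun {ffun 'I_m -> int} -> R with 0}.

Definition laurent_monomial (K : fieldType) (m : nat) (x : m.-tuple K)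
    (e : {ffun 'I_m -> int}) : K :=
  \prod_(i < m) tnth x i ^ e i.

Definition laurent_eval (R : nmodType) (K : fieldType) (h : R -> K) (m : nat)
    (x : m.-tuple K) (f : laurent R m) : K :=
  \sum_(e <- finsupp f) h (f e) * laurent_monomial x e.

(* The ring ZP is realised inside its fraction field QP, which is also the     *)
(* fraction field of the polynomial ring in the r frozen variables.            *)
Definition QP (r : nat) : fieldType := {fraction {mpoly int[r]}}.

Definition frozen (r : nat) : r.-tuple (QP r) :=
  [tuple tofrac ('X_k : {mpoly int[r]}) | k < r].

Definition ZP (r : nat) (p : QP r) : Prop :=
  exists f : laurent int r, p = laurent_eval intr (frozen r) f.

Definition ZPnneg (r : nat) (p : QP r) : Prop :=
  exists f : laurent int r,
    (forall e, 0 <= f e) /\ p = laurent_eval intr (frozen r) f.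

(* F is the field of rational functions in n variables over QP, via iota.      *)
Definition is_ratfun_field (n r : nat) (F : fieldType)
    (iota : {rmorphism QP r -> F}) : Prop :=
  exists phi : {rmorphism {fraction {mpoly (QP r)[n]}} -> F},
    bijective phi /\ forall c : QP r, phi (tofrac c%:MP_[n]) = iota c.

Definition alg_independent (n r : nat) (F : fieldType)
    (iota : {rmorphism QP r -> F}) (x : n.-tuple F) : Prop :=
  forall p : {mpoly (QP r)[n]}, mmap iota (tnth x) p = 0 -> p = 0.

Definition field_generating (n r : nat) (F : fieldType)
    (iota : {rmorphism QP r -> F}) (x : n.-tuple F) : Prop :=
  forall z : F, exists p q : {mpoly (QP r)[n]},
    mmap iota (tnth x) q != 0 /\
    z = mmap iota (tnth x) p / mmap iota (tnth x) q.

Definition skew_symmetric (n : nat) (B : 'M[int]_n) : Prop := B^T = - B.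

Definition labeled_pair (n r : nat) (F : fieldType) : Type :=
  ('M[int]_(n + r, n) * n.-tuple F)%type.

Definition is_seed (n r : nat) (F : fieldType) (iota : {rmorphism QP r -> F})
    (s : labeled_pair n r F) : Prop :=
  [/\ skew_symmetric (usubmx s.1), alg_independent iota s.2
    & field_generating iota s.2].

Definition extended_cluster (n r : nat) (F : fieldType)
    (iota : {rmorphism QP r -> F}) (x : n.-tuple F) (j : 'I_(n + r)) : F :=
  match split j with
  | inl k => tnth x k
  | inr k => iota (tnth (frozen r) k)
  end.

(* The numerator is always even, so the integer quotient is exact.             *)
Definition mutate_matrix (n r : nat) (i : 'I_n) (B : 'M[int]_(n + r, n)) :
    'M[int]_(n + r, n) :=
  \matrix_(k, j)
    if (k == lshift r i) || (j == i) then - B k j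
    else B k j + ((B k i * `|B (lshift r i) j| + `|B k i| * B (lshift r i) j)
                    %/ 2)%Z.

Definition mutate_cluster (n r : nat) (F : fieldType)
    (iota : {rmorphism QP r -> F}) (i : 'I_n) (B : 'M[int]_(n + r, n))
    (x : n.-tuple F) : n.-tuple F :=
  [tuple if k == i then
      (tnth x i)^-1 *
      (\prod_(j < n + r) extended_cluster iota x j ^ Num.max 0 (B j i) +
       \prod_(j < n + r) extended_cluster iota x j ^ Num.max 0 (- B j i))
    else tnth x k | k < n].

Definition mutate (n r : nat) (F : fieldType) (iota : {rmorphism QP r -> F})
    (s : labeled_pair n r F) (i : 'I_n) : labeled_pair n r F :=
  (mutate_matrix i s.1, mutate_cluster iota i s.1 s.2).

Section ClusterAlgebra.

Variables (n r : nat) (F : fieldType) (iota : {rmorphism QP r -> F}).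
Variable s0 : labeled_pair n r F.

Definition is_cluster (x : n.-tuple F) : Prop :=
  exists ks : seq 'I_n, x = (foldl (mutate iota) s0 ks).2.

Inductive in_cluster_algebra : F -> Prop :=
| ica_coef p : ZP p -> in_cluster_algebra (iota p)
| ica_var x i : is_cluster x -> in_cluster_algebra (tnth x i)
| ica_add u v : in_cluster_algebra u -> in_cluster_algebra v ->
    in_cluster_algebra (u + v)
| ica_mul u v : in_cluster_algebra u -> in_cluster_algebra v ->
    in_cluster_algebra (u * v).

Definition monomial (x : n.-tuple F) (a : {ffun 'I_n -> nat}) : F :=
  \prod_(i < n) tnth x i ^+ a i.

Definition cluster_monomial (z : F) : Prop :=
  exists x, is_cluster x /\ exists a, z = monomial x a.

Definition positive (z : F) : Prop :=
  forall x, is_cluster x ->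
  exists f : laurent (QP r) n,
    (forall e, ZPnneg (f e)) /\ z = laurent_eval iota x f.

Definition linear_combination (C : QP r -> Prop) (G : F -> Prop) (z : F) :
    Prop :=
  exists s : seq (QP r * F),
    (forall t, t \in s -> C t.1 /\ G t.2) /\
    z = \sum_(t <- s) iota t.1 * t.2.

Definition proper_laurent_monomial (x : n.-tuple F) (z : F) : Prop :=
  exists c : {ffun 'I_n -> int},
    (exists l, c l < 0) /\ z = laurent_monomial x c.

(* Here [x =i x'] compares the clusters as unordered sets.                     *)
Definition proper_laurent_monomial_property : Prop :=
  forall x x' : n.-tuple F, is_cluster x -> is_cluster x' -> ~ (x =i x') ->
  forall a : {ffun 'I_n -> nat},
    (exists i, tnth x' i \notin x /\ (0 < a i)%N) ->
    linear_combination (@ZP r) (proper_laurent_monomial x) (monomial x' a).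

(* Finite families of pairwise distinct elements of G.                         *)
Definition linearly_independent (C : QP r -> Prop) (G : F -> Prop) : Prop :=
  forall (s : seq F) (c : F -> QP r),
    uniq s -> (forall m, m \in s -> G m /\ C (c m)) ->
    \sum_(m <- s) iota (c m) * m = 0 ->
    forall m, m \in s -> c m = 0.

End ClusterAlgebra.

(* Main.v *)
Require Import Defs.
From HB Require Import structures.
From mathcomp Require Import all_boot all_order all_algebra.
From mathcomp Require Import finmap.
From mathcomp Require Import mpoly.
From mathcomp Require Import ring.

Set Implicit Arguments.
Unset Strict Implicit.
Unset Printing Implicit Defensive.

Import Order.TTheory GRing.Theory Num.Theory.

Local Open Scope ring_scope.

(** Fix a cluster [x] and a cluster monomial [x^a], and expand a combination of
    distinct cluster monomials in Laurent monomials in [x].  A cluster monomial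
    involving a variable outside [x] contributes only proper Laurent monomials,
    by hypothesis, and any other one is a monomial in [x]; so the coefficient of
    the Laurent monomial [x^a] is exactly the coefficient of [x^a] in the
    combination.  It vanishes if the combination does, and it lies in
    [Z_{>=0}P] if the combination is positive.  Comparing coefficients requires
    every cluster to be algebraically independent, which is preserved by
    mutation. *)

(** * Skew-symmetry under matrix mutation *)

(** Equal signs give [a * b] twice up to sign, opposite signs cancel. Hence the quotient by 2 in
    [mutate_matrix] is exact and commutes with negation. *)
Lemma even_mutation_numerator (a b : int) :
  exists q, a * `|b| + `|a| * b = q * 2.
Proof.
case: (ger0P a) => _; case: (ger0P b) => _.
- by exists (a * b); ring.
- by exists 0; ring.
- by exists 0; ring.
- by exists (- (a * b)); ring.
Qed.

Lemma skew_symmetricE (n : nat) (B : 'M[int]_n) :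
  skew_symmetric B -> forall k j, B k j = - B j k.
Proof. by move=> /matrixP skB k j; move: (skB j k); rewrite !mxE. Qed.

Lemma skew_symmetric_mutate (n r : nat) (i : 'I_n) (B : 'M[int]_(n + r, n)) :
  skew_symmetric (usubmx B) -> skew_symmetric (usubmx (mutate_matrix i B)).
Proof.
move=> /skew_symmetricE skB.
have skB' k j : B (lshift r k) j = - B (lshift r j) k.
  by have := skB k j; rewrite !mxE.
apply/matrixP => k j; rewrite !mxE !(inj_eq (@lshift_inj _ _)) orbC.
case: ifP => _; first by rewrite skB'.
have [q qE] := even_mutation_numerator (B (lshift r k) i) (B (lshift r i) j).
rewrite (skB' j k) (skB' j i) (skB' i k) !normrN qE mulzK //.
have -> : - B (lshift r i) j * `|B (lshift r k) i| +
    `|B (lshift r i) j| * - B (lshift r k) i = - q * 2.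
  by rewrite [RHS]mulNr -qE; ring.
by rewrite mulzK // opprD.
Qed.

(** * Algebraic independence under mutation *)

(** In the application [P] is the exchange polynomial and [u], [v] are a cluster and its mutation at
    [i]: substituting [P(u) / u i] for [v i] makes [p(v)] a fraction whose denominator is a power of
    [u i]. One numerator [q] serves both directions because the hypotheses are symmetric in [u] and
    [v]. *)
Lemma mmap_clear_denominators (n : nat) (R F : fieldType)
    (h : {rmorphism R -> F}) (i : 'I_n) (P : {mpoly R[n]}) (u v : 'I_n -> F) :
  (forall j, j != i -> u j = v j) ->
  u i * v i = mmap h u P -> mmap h v P = mmap h u P ->
  forall p : {mpoly R[n]}, exists N q,
    mmap h u q = u i ^+ N * mmap h v p /\ mmap h v q = v i ^+ N * mmap h u p.
Proof.
move=> uv uvi vuP.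
pose good (p : {mpoly R[n]}) := exists N q,
  mmap h u q = u i ^+ N * mmap h v p /\ mmap h v q = v i ^+ N * mmap h u p.
have goodM p q : good p -> good q -> good (p * q).
  move=> [N [p' [p1 p2]]] [M [q' [q1 q2]]]; exists (N + M)%N, (p' * q').
  by rewrite !rmorphM /= p1 p2 q1 q2 !exprD; split; ring.
have goodD p q : good p -> good q -> good (p + q).
  move=> [N [p' [p1 p2]]] [M [q' [q1 q2]]].
  exists (N + M)%N, ('X_i ^+ M * p' + 'X_i ^+ N * q').
  rewrite !rmorphD /= !rmorphM /= !rmorphXn /= !mmapX !mmap1U p1 p2 q1 q2 !exprD.
  by split; ring.
have goodC c : good c%:MP by exists 0%N, c%:MP; rewrite !mmapC !mul1r.
have goodX j : good 'X_j.
  have [->|ji] := eqVneq j i.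
    (* Since [u i * v i] is the value of [P] at both points, [P] is the numerator, with exponent
       1. *)
    exists 1%N, P; rewrite !mmapX !mmap1U !expr1 vuP -uvi; split=> //.
    by rewrite mulrC.
  by exists 0%N, 'X_j; rewrite !mmapX !mmap1U !mul1r uv.
have goodXn j k : good ('X_j ^+ k).
  by elim: k => [|k IH]; [rewrite expr0; exact: goodC | rewrite exprS; exact: goodM].
have goodXm (m : 'X_{1..n}) : good 'X_[m].
  rewrite mpolyXE_id; apply: (@big_ind _ good) => [||j _]; last exact: goodXn.
    exact: goodC.
  exact: goodM.
apply: mpolyind => [|c m p _ _ gp]; first by rewrite -mpolyC0; exact: goodC.
by apply: goodD gp; rewrite -mul_mpolyC; apply: goodM.
Qed.

Section Exchange.

Variables (n r : nat) (F : fieldType) (iota : {rmorphism QP r -> F}).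

Definition extended_mpoly (j : 'I_(n + r)) : {mpoly (QP r)[n]} :=
  match split j with
  | inl k => 'X_k
  | inr k => (tnth (frozen r) k)%:MP
  end.

Definition exchange_mpoly (i : 'I_n) (B : 'M[int]_(n + r, n)) :
    {mpoly (QP r)[n]} :=
  \prod_(j < n + r) extended_mpoly j ^+ absz (Num.max 0 (B j i)) +
  \prod_(j < n + r) extended_mpoly j ^+ absz (Num.max 0 (- B j i)).

Lemma exchange_mpoly_neq0 i B : exchange_mpoly i B != 0.
Proof.
pose w (j : 'I_(n + r)) : {mpoly int[r]} :=
  match split j with inl k => 1 | inr k => 'X_k end.
pose t : {mpoly int[r]} := \prod_j w j ^+ absz (Num.max 0 (B j i)) +
  \prod_j w j ^+ absz (Num.max 0 (- B j i)).
have tE : mmap idfun (fun=> 1) (exchange_mpoly i B) =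
    FracField.tofrac t :> QP r.
  rewrite !rmorphD /= !rmorph_prod /=.
  congr (_ + _); apply: eq_bigr => j _; rewrite !rmorphXn; congr (_ ^+ _);
    rewrite /extended_mpoly /w; case: (split j) => k /=;
    by rewrite ?mmapC ?mmapX ?mmap1U ?rmorph1 ?tnth_mktuple.
have t1 : meval (fun=> 1) t = 2%:R.
  rewrite rmorphD /= !rmorph_prod /= !big1 // => j _; rewrite rmorphXn /=;
  by rewrite /w; case: (split j) => k /=; rewrite ?meval1 ?mevalXU expr1n.
apply/eqP => P0; move: tE; rewrite P0 rmorph0 => /esym/eqP.
by rewrite tofrac_eq0 => /eqP t0; move: t1; rewrite t0 rmorph0.
Qed.

Lemma mmap_extended_mpoly (x : n.-tuple F) j :
  mmap iota (tnth x) (extended_mpoly j) = extended_cluster iota x j.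
Proof.
rewrite /extended_mpoly /extended_cluster.
by case: (split j) => k; rewrite ?mmapC ?mmapX ?mmap1U.
Qed.

Lemma max0_absz (b : int) (y : F) : y ^+ absz (Num.max 0 b) = y ^ Num.max 0 b.
Proof. by rewrite exprnP gez0_abs // le_max lexx. Qed.

Lemma mmap_exchange_mpoly (x : n.-tuple F) i B :
  mmap iota (tnth x) (exchange_mpoly i B) =
  \prod_(j < n + r) extended_cluster iota x j ^ Num.max 0 (B j i) +
  \prod_(j < n + r) extended_cluster iota x j ^ Num.max 0 (- B j i).
Proof.
rewrite rmorphD /= !rmorph_prod /=.
by congr (_ + _); apply: eq_bigr => j _;
  rewrite rmorphXn /= mmap_extended_mpoly max0_absz.
Qed.

(** The zero entry [B (lshift r i) i] is the exponent of the [i]-th variable, so the exchange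
    polynomial does not involve it. *)
Lemma exchange_mpoly_indep (x y : n.-tuple F) i (B : 'M[int]_(n + r, n)) :
  B (lshift r i) i = 0 -> (forall j, j != i -> tnth x j = tnth y j) ->
  mmap iota (tnth x) (exchange_mpoly i B) =
  mmap iota (tnth y) (exchange_mpoly i B).
Proof.
move=> Bii xy; rewrite !mmap_exchange_mpoly.
congr (_ + _); apply: eq_bigr => j _;
  (have [->|ji] := eqVneq j (lshift r i); first by rewrite Bii ?oppr0 maxxx);
  congr (_ ^ _); rewrite /extended_cluster;
  case: split_ordP ji => // k -> ki; apply: xy;
  by apply: contraNneq ki => ->.
Qed.

Lemma alg_independent_neq0 (x : n.-tuple F) :
  alg_independent iota x -> forall i, tnth x i != 0.
Proof.
move=> ax i; apply/eqP => xi0; have := ax 'X_i.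
rewrite mmapX mmap1U => /(_ xi0) /(congr1 (mcoeff U_(i))).
by rewrite mcoeffXU eqxx mcoeff0 => /eqP; rewrite oner_eq0.
Qed.

(* The exchange relation is symmetric in [x] and its mutation [y]: clearing the
   denominator of [p(y)] yields a polynomial [q] that vanishes at [x], hence
   [q = 0], and [q(y) = 0] is the relation [p(x) = 0] up to a power of [y_i]. *)
Lemma alg_independent_mutate (x : n.-tuple F) i (B : 'M[int]_(n + r, n)) :
  B (lshift r i) i = 0 -> alg_independent iota x ->
  alg_independent iota (mutate_cluster iota i B x).
Proof.
move=> Bii ax; set y := mutate_cluster _ _ _ _.
have xy j : j != i -> tnth x j = tnth y j.
  by move=> ji; rewrite tnth_mktuple (negbTE ji).
have xi0 := alg_independent_neq0 ax i.
have xyi : tnth x i * tnth y i = mmap iota (tnth x) (exchange_mpoly i B).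
  by rewrite tnth_mktuple eqxx mulVKf // mmap_exchange_mpoly.
have yi0 : tnth y i != 0.
  have : mmap iota (tnth x) (exchange_mpoly i B) != 0.
    by apply: contraNneq (exchange_mpoly_neq0 i B) => /ax ->.
  by rewrite -xyi mulf_eq0 => /norP[].
move=> p py0.
have yx := esym (exchange_mpoly_indep Bii xy).
have [N [q [qx qy]]] := mmap_clear_denominators xy xyi yx p.
rewrite py0 mulr0 in qx; move: qy; rewrite (ax _ qx) mmap0 => /esym/eqP.
by rewrite mulf_eq0 expf_eq0 (negbTE yi0) andbF /= => /eqP/ax.
Qed.

Lemma is_cluster_alg_independent (s0 : labeled_pair n r F) x :
  is_seed iota s0 -> is_cluster iota s0 x -> alg_independent iota x.
Proof.
move=> [sk0 a0 _] [ks ->].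
(* Skew-symmetry is carried along the induction because it makes the diagonal entry at the mutated
   index zero. *)
suff: skew_symmetric (usubmx (foldl (mutate iota) s0 ks).1) /\
      alg_independent iota (foldl (mutate iota) s0 ks).2 by case.
elim/last_ind: ks => [|ks i [sk a]]; first by [].
rewrite foldl_rcons /=; split; first exact: skew_symmetric_mutate.
apply: alg_independent_mutate => //.
have := skew_symmetricE sk i i; rewrite !mxE => /eqP.
by rewrite -addr_eq0 -mulr2n mulrn_eq0 => /eqP.
Qed.

End Exchange.

(** * Collecting terms and comparing Laurent coefficients *)

Lemma sum_fibers (T I : eqType) (V : nmodType) (s : seq T) (k : T -> I)
    (f : T -> V) :
  \sum_(g <- undup (map k s)) \sum_(t <- s | k t == g) f t =
  \sum_(t <- s) f t.
Proof.
rewrite (exchange_big_dep predT) //= big_seq [RHS]big_seq.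
apply: eq_bigr => t ts; rewrite -big_filter.
rewrite (@eq_filter _ _ (pred1 (k t))) => [|g]; last exact: eq_sym.
by rewrite filter_pred1_uniq ?undup_uniq ?big_seq1 // mem_undup map_f.
Qed.

Section LaurentExpansion.

Variables (n r : nat) (F : fieldType) (iota : {rmorphism QP r -> F}).
Variables (x : n.-tuple F) (ax : alg_independent iota x).

(** Multiplication by a power of the product of the variables turns the relation into a polynomial
    one. The list may repeat exponents, so a coefficient is a sum. *)
Lemma laurent_coef_eq0 (s : seq (QP r * {ffun 'I_n -> int})) :
  \sum_(t <- s) iota t.1 * laurent_monomial x t.2 = 0 ->
  forall e, \sum_(t <- s | t.2 == e) t.1 = 0.
Proof.
move=> s0 e; have x0 := alg_independent_neq0 ax.
(* A bound for all exponents involved; the dummy pair [(0, e)] makes it cover [e], so that the shift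
   [m] separates [e] from the other exponents of [s]. *)
pose N : nat := (\sum_(t <- (0%R : QP r, e) :: s) \sum_(i < n) absz (t.2 i))%N.
have shift_ge0 (t : QP r * {ffun 'I_n -> int}) i :
    t \in (0 : QP r, e) :: s -> 0 <= t.2 i + N%:Z.
  move=> ts; suff : (absz (t.2 i) <= N)%N.
    move=> tN; rewrite -(opprK (t.2 i)) addrC subr_ge0.
    by apply: le_trans (ler_norm _) _; rewrite normrN -abszE lez_nat.
  rewrite /N (big_rem t ts) /= (bigD1 i) //= -addnA; exact: leq_addr.
pose m (f : {ffun 'I_n -> int}) : 'X_{1..n} :=
  [multinom absz (f i + N%:Z)%R | i < n].
pose p : {mpoly (QP r)[n]} := \sum_(t <- s) t.1 *: 'X_[m t.2].
have p0 : p = 0.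
  apply: ax; rewrite raddf_sum /=.
  rewrite (eq_big_seq (fun t => (\prod_(i < n) tnth x i ^+ N) *
      (iota t.1 * laurent_monomial x t.2))); last first.
    move=> t ts; rewrite mmapZ mmapX mulrCA; congr (_ * _).
    rewrite -big_split /=; apply: eq_bigr => i _.
    rewrite mnmE exprnP gez0_abs; last by apply: shift_ge0; rewrite inE ts orbT.
    by rewrite addrC expfzDr.
  by rewrite -mulr_sumr s0 mulr0.
have := congr1 (mcoeff (m e)) p0; rewrite mcoeff0 raddf_sum => pe; rewrite -[RHS]pe.
rewrite big_mkcond; apply: eq_big_seq => t ts /=.
rewrite mcoeffZ mcoeffX; have [->|te] := eqVneq t.2 e; first by rewrite eqxx mulr1.
case: eqP => [/mnmP mte|]; last by rewrite mulr0.
case/eqP: te; apply/ffunP => i; have := mte i; rewrite !mnmE => /(congr1 Posz).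
rewrite !gez0_abs; first exact: addIr.
  by apply: (shift_ge0 (0 : QP r, e)); rewrite mem_head.
by apply: shift_ge0; rewrite inE ts orbT.
Qed.

Definition int_exponent (a : {ffun 'I_n -> nat}) : {ffun 'I_n -> int} :=
  [ffun i => (a i)%:Z].

Lemma laurent_monomial_int_exponent a :
  laurent_monomial x (int_exponent a) = monomial x a.
Proof. by apply: eq_bigr => i _; rewrite ffunE exprnP. Qed.

Lemma monomial_of_mem (y : n.-tuple F) (a : {ffun 'I_n -> nat}) :
  (forall i, (0 < a i)%N -> tnth y i \in x) ->
  exists b, monomial y a = monomial x b.
Proof.
move=> yx; pose P z := exists b, z = monomial x b.
have P1 : P 1.
  by exists [ffun=> 0%N]; rewrite /monomial big1 // => i _; rewrite ffunE.
have PM u v : P u -> P v -> P (u * v).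
  move=> [b ->] [c ->]; exists [ffun i => (b i + c i)%N].
  by rewrite /monomial -big_split; apply: eq_bigr => i _; rewrite ffunE exprD.
have PX j : P (tnth x j).
  exists [ffun i => (i == j) : nat]; rewrite /monomial (bigD1 j) //= big1.
    by rewrite ffunE eqxx mulr1.
  by move=> i /negbTE ij; rewrite ffunE ij.
apply: (@big_ind _ P) => // i _; case: (posnP (a i)) => [->//|/yx/tnthP[j ->]].
by elim: (a i) => [//|k IH]; rewrite exprS; exact: PM.
Qed.

End LaurentExpansion.

(** * Coefficients of cluster monomials *)

Section ClusterMonomials.

Variables (n r : nat) (F : fieldType) (iota : {rmorphism QP r -> F}).
Variables (s0 : labeled_pair n r F) (seed0 : is_seed iota s0).
Hypothesis plmp : proper_laurent_monomial_property iota s0.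

Lemma cluster_monomial_expansion x a g :
  is_cluster iota s0 x -> cluster_monomial iota s0 g ->
  exists l : seq (QP r * {ffun 'I_n -> int}),
    g = \sum_(t <- l) iota t.1 * laurent_monomial x t.2 /\
    \sum_(t <- l | t.2 == int_exponent a) t.1 = (g == monomial x a)%:R.
Proof.
move=> cx [y [cy [b gE]]].
have [-> | ga] := eqVneq g (monomial x a).
  exists [:: (1, int_exponent a)].
  rewrite big_seq1 big_mkcond big_seq1 /= eqxx rmorph1 mul1r.
  by rewrite laurent_monomial_int_exponent.
have [yx|] := boolP [forall i, (0 < b i)%N ==> (tnth y i \in x)].
  have [c yc] : exists c, monomial y b = monomial x c.
    by apply: monomial_of_mem => i; apply/implyP; exact: (forallP yx).
  exists [:: (1, int_exponent c)].
  rewrite big_seq1 big_mkcond big_seq1 /= rmorph1 mul1r laurent_monomial_int_exponent.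
  split; first by rewrite gE.
  case: eqP => // ca; case/eqP: ga.
  by rewrite gE yc -!(laurent_monomial_int_exponent x) ca.
rewrite negb_forall => /existsP[i]; rewrite negb_imply => /andP[bi yix].
have xy : ~ (x =i y) by move=> xy; rewrite xy mem_tnth in yix.
have [l [lP lE]] := plmp cx cy xy (ex_intro _ i (conj yix bi)).
have {lE} : g = \sum_(t <- l) iota t.1 * t.2 by rewrite gE.
(* The induction keeps only the expansion of [g] in proper Laurent monomials; the coefficient to
   reach is now 0. *)
elim: l g {gE ga} lP => [|t l IH] g lP ->.
  by exists [::]; rewrite !big_nil.
have [||l' [lE l0]] := IH (\sum_(t <- l) iota t.1 * t.2) => //.
  by move=> u ul; apply: lP; rewrite inE ul orbT.
have [_ [c [[k ck] tc]]] := lP t (mem_head _ _).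
exists ((t.1, c) :: l'); rewrite !big_cons /= lE tc l0.
case: eqP => // cE.
by move: ck; rewrite cE ffunE.
Qed.

Lemma linear_combination_expansion x a (s : seq (QP r * F)) :
  is_cluster iota s0 x ->
  (forall t, t \in s -> cluster_monomial iota s0 t.2) ->
  exists l : seq (QP r * {ffun 'I_n -> int}),
    \sum_(t <- s) iota t.1 * t.2 =
      \sum_(t <- l) iota t.1 * laurent_monomial x t.2 /\
    \sum_(t <- l | t.2 == int_exponent a) t.1 =
      \sum_(t <- s | t.2 == monomial x a) t.1.
Proof.
move=> cx; elim: s => [|t s IH] sP; first by exists [::]; rewrite !big_nil.
have [|l [lE la]] := IH; first by move=> u us; apply: sP; rewrite inE us orbT.
have [l' [tE ta]] := cluster_monomial_expansion a cx (sP t (mem_head _ _)).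
exists ([seq (t.1 * u.1, u.2) | u <- l'] ++ l).
rewrite !big_cat !big_cons !big_map /= lE la {1}tE; split.
  congr (_ + _); rewrite mulr_sumr; apply: eq_bigr => u _.
  by rewrite rmorphM mulrA.
rewrite -mulr_sumr ta; case: eqP => _; first by rewrite mulr1.
by rewrite mulr0 add0r.
Qed.

(** Subtracting [f] from the expansion of the left side gives a relation among Laurent monomials in
    [x], and algebraic independence kills each coefficient. *)
Lemma linear_combination_coef x a (s : seq (QP r * F)) (f : laurent (QP r) n) :
  is_cluster iota s0 x ->
  (forall t, t \in s -> cluster_monomial iota s0 t.2) ->
  \sum_(t <- s) iota t.1 * t.2 = laurent_eval iota x f ->
  \sum_(t <- s | t.2 == monomial x a) t.1 = f (int_exponent a).
Proof.
move=> cx sP sf; have ax := is_cluster_alg_independent seed0 cx.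
have [l [lE <-]] := linear_combination_expansion a cx sP.
pose l' := [seq (- f e, e) | e <- finsupp f].
have := laurent_coef_eq0 ax (s := l ++ l') _ (int_exponent a).
rewrite !big_cat !big_map /= -lE sf => l0.
apply/eqP; rewrite -subr_eq0 -[X in _ == X]l0.
  apply/eqP; congr (_ + _); have [ef|ef] := boolP (int_exponent a \in finsupp f).
    by rewrite -big_filter filter_pred1_uniq ?fset_uniq // big_seq1.
  rewrite fsfun_dflt // oppr0 big1_seq // => e /andP[/eqP ->].
  by rewrite (negbTE ef).
by rewrite -big_split big1 // => e _; rewrite rmorphN mulNr /= subrr.
Qed.

Lemma linear_combination_cluster_monomial_nneg z :
  positive iota s0 z ->
  linear_combination iota (@ZP r) (cluster_monomial iota s0) z ->
  linear_combination iota (@ZPnneg r) (cluster_monomial iota s0) z.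
Proof.
move=> zpos [s [sP zs]].
(* Terms with the same cluster monomial are merged: it is their total coefficient that occurs in a
   Laurent expansion of [z]. *)
exists [seq (\sum_(t <- s | t.2 == g) t.1, g) | g <- undup (map snd s)].
have sG t : t \in s -> cluster_monomial iota s0 t.2 by move=> /sP[].
split=> [_ /mapP[g + ->] /= | ].
  rewrite mem_undup => /mapP[t ts gt].
  split; last by rewrite gt; exact: sG.
  have [x [cx [a ga]]] := sG t ts; have [f [f0 zf]] := zpos x cx.
  by rewrite gt ga (linear_combination_coef (f := f) _ cx) // -zs.
rewrite big_map zs -(sum_fibers s snd) /=; apply: eq_bigr => g _.
by rewrite rmorph_sum mulr_suml; apply: eq_bigr => t /eqP ->.
Qed.

Lemma linearly_independent_cluster_monomials :
  linearly_independent iota (@ZP r) (cluster_monomial iota s0).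
Proof.
move=> s c us sP sc0 g gs.
have [[x [cx [a ga]]] _] := sP g gs.
(* The empty [[fsfun]] is the zero Laurent polynomial, so [sc0] becomes an expansion of 0. *)
have := @linear_combination_coef x a [seq (c m, m) | m <- s]
  [fsfun] cx.
rewrite /laurent_eval finsupp0 !big_map /= big_nil fsfun_dflt ?inE // -ga.
move=> coef; rewrite -(coef _ sc0).
  by rewrite -big_filter filter_pred1_uniq // big_seq1.
by move=> _ /mapP[m ms ->] /=; have [] := sP m ms.
Qed.

End ClusterMonomials.

Theorem theorem6p4 (n r : nat) (hn : (0 < n)%N) (F : fieldType)
    (iota : {rmorphism QP r -> F}) (hF : is_ratfun_field n iota)
    (B : 'M[int]_n) (hB : skew_symmetric B)
    (Bt : 'M[int]_(n + r, n)) (hBt : usubmx Bt = B)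
    (x : n.-tuple F) (hx : is_seed iota (Bt, x))
    (hP : proper_laurent_monomial_property iota (Bt, x)) :
  (forall z : F,
     in_cluster_algebra iota (Bt, x) z ->
     positive iota (Bt, x) z ->
     linear_combination iota (@ZP r) (cluster_monomial iota (Bt, x)) z ->
     linear_combination iota (@ZPnneg r) (cluster_monomial iota (Bt, x)) z) /\
  linearly_independent iota (@ZP r) (cluster_monomial iota (Bt, x)).
Proof.
split=> [z _|]; first exact: linear_combination_cluster_monomial_nneg.
exact: linearly_independent_cluster_monomials.
Qed.
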